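(* Let $R$ be a finite ring with identity, $M$ a finite Frobenius $(R,R)$-bimodule with generating character $\chi$, $n\in\mathbb{N}$, and let $\mathcal{U}$ be a subgroup of $\mathrm{GL}_n(R)$. Then \[ \mathcal{P}_{R^n,\,\mathcal{U}}=\widehat{\mathcal{P}_{M^n,\,\mathcal{U}^{\top}}}^{[\chi,r]},\quad \mathcal{P}_{R^n,\,\mathcal{U}^{\top}}=\widehat{\mathcal{P}_{M^n,\,\mathcal{U}}}^{[\chi,l]},\quad \mathcal{P}_{M^n,\,\mathcal{U}}=\widehat{\mathcal{P}_{R^n,\,\mathcal{U}^{\top}}}^{[\chi,r]},\quad \mathcal{P}_{M^n,\,\mathcal{U}^{\top}}=\widehat{\mathcal{P}_{R^n,\,\mathcal{U}}}^{[\chi,l]}. \] As a consequence, all these partitions are reflexive. Moreover, the right (resp. left) group action of $\mathcal{U}$ on $R^n$ and the left (resp. right) action of $\mathcal{U}$ on $M^n$ lead to the same number of orbits.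
   Context: Frobenius bimodules: For a finite ring $R$ with identity, $\widehat{R}=\mathrm{Hom}((R,+),\mathbb{C}^* )$ is an $(R,R)$-bimodule via $(r\cdot\psi)(a)=\psi(ar)$, $(\psi\cdot r)(a)=\psi(ra)$. A finite $(R,R)$-bimodule $M$ is a Frobenius bimodule if ${}_RM\cong{}_R\widehat{R}$ as left and $M_R\cong\widehat{R}_R$ as right $R$-modules. The character group $\widehat{M}=\mathrm{Hom}((M,+),\mathbb{C}^* )$ is an $(R,R)$-bimodule via $(r\cdot\psi)(v)=\psi(vr)$, $(\psi\cdot r)(v)=\psi(rv)$. A generating character of $M$ is $\chi\in\widehat{M}$ with $\widehat{M}=R\chi$; for Frobenius bimodules this is known to be equivalent to $\widehat{M}=\chi R$, and such $\chi$ exists. Actions: For $V=R$ or $V=M$, elements of $V^n$ are row vectors. A subgroup $\mathcal{U}\le\mathrm{GL}_n(R)$ acts on $V^n$ from the right by $(v,U)\mapsto vU$ and from the left by $(U,v)\mapsto (Uv^{\top})^{\top}$ (where $v^\top$ is the column vector). The corresponding orbit partitions of $V^n$ are denoted $\mathcal{P}_{V^n,\,\mathcal{U}}$ (right action) and $\mathcal{P}_{V^n,\,\mathcal{U}^{\top}}$ (left action). Dual partitions: For $r\in R^n$, $v\in M^n$ put $\langle r,v\rangle=\sum_i r_iv_i\in M$ and $\langle v,r\rangle=\sum_i v_ir_i\in M$. For a partition $\mathcal{P}=(P_k)_k$ of $R^n$, the partitions $\widehat{\mathcal{P}}^{[\chi,l]}$ and $\widehat{\mathcal{P}}^{[\chi,r]}$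 of $M^n$ are given by the equivalence relations: $v\sim v'$ iff $\sum_{r\in P_k}\chi(\langle r,v\rangle)=\sum_{r\in P_k}\chi(\langle r,v'\rangle)$ for all $k$ (for $[\chi,l]$), and $v\sim v'$ iff $\sum_{r\in P_k}\chi(\langle v,r\rangle)=\sum_{r\in P_k}\chi(\langle v',r\rangle)$ for all $k$ (for $[\chi,r]$). For a partition $\mathcal{Q}=(Q_k)_k$ of $M^n$, the partitions $\widehat{\mathcal{Q}}^{[\chi,l]}$ and $\widehat{\mathcal{Q}}^{[\chi,r]}$ of $R^n$ are given by: $r\sim r'$ iff $\sum_{v\in Q_k}\chi(\langle v,r\rangle)=\sum_{v\in Q_k}\chi(\langle v,r'\rangle)$ for all $k$ (for $[\chi,l]$), and $r\sim r'$ iff $\sum_{v\in Q_k}\chi(\langle r,v\rangle)=\sum_{v\in Q_k}\chi(\langle r',v\rangle)$ for all $k$ (for $[\chi,r]$). Reflexivity: For a partition $\mathcal{P}=(P_k)_k$ of a finite abelian group $A$, the dual partition $\widehat{\mathcal{P}}$ of $\widehat{A}=\mathrm{Hom}(A,\mathbb{C}^* )$ is given by $\psi\sim\psi'$ iff $\sum_{a\in P_k}\psi(a)=\sum_{a\in P_k}\psi'(a)$ for all $k$. $\mathcal{P}$ is reflexive if $\mathcal{P}=\widehat{\widehat{\mathcal{P}}}$, where $A$ is identified with $\widehat{\widehat{A}}$ via evaluation. Two partitions are equal if they have the same blocks. *)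

(* Defs.v *)
From HB Require Import structures.
From mathcomp Require Import all_boot all_order all_algebra.

Set Implicit Arguments.
Unset Strict Implicit.
Unset Printing Implicit Defensive.

Import GRing.Theory.

Local Open Scope ring_scope.

(* FinRing.Lmodule assumes a nontrivial scalar ring; here R may be the zero   *)
(* ring, so both scalings are given by one interface.                         *)
HB.mixin Record Zmodule_isBimodule (R : pzRingType) M of GRing.Zmodule M := {
  lscale : R -> M -> M;
  rscale : M -> R -> M;
  lscaleDl : forall r s (v : M), lscale (r + s) v = lscale r v + lscale s v;
  lscaleDr : forall r (v w : M), lscale r (v + w) = lscale r v + lscale r w;
  lscaleA : forall r s (v : M), lscale r (lscale s v) = lscale (r * s) v;
  lscale1 : forall v : M, lscale 1 v = v;
  rscaleDl : forall (v w : M) r, rscale (v + w) r = rscale v r + rscale w r;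
  rscaleDr : forall (v : M) r s, rscale v (r + s) = rscale v r + rscale v s;
  rscaleA : forall (v : M) r s, rscale (rscale v r) s = rscale v (r * s);
  rscale1 : forall v : M, rscale v 1 = v;
  rscale_lscale : forall r (v : M) s,
    rscale (lscale r v) s = lscale r (rscale v s)
}.

#[short(type="finBimodType")]
HB.structure Definition FinBimodule (R : pzRingType) :=
  {M of GRing.Zmodule M & Finite M & Zmodule_isBimodule R M}.

Section RegularBimodule.

Variable R : finPzRingType.

Let mulrA' (v r s : R) : v * r * s = v * (r * s).
Proof. by rewrite mulrA. Qed.
Let mulrA_sym (r v s : R) : r * v * s = r * (v * s).
Proof. by rewrite mulrA. Qed.

HB.instance Definition _ := Zmodule_isBimodule.Build R R^o
  (lscale := fun r s : R => r * s) (rscale := fun r s : R => r * s)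
  (fun r s v : R => mulrDl r s v) (fun r v w : R => mulrDr r v w)
  (fun r s v : R => mulrA r s v) (fun v : R => mul1r v)
  (fun v w r : R => mulrDl v w r) (fun v r s : R => mulrDr v r s)
  mulrA' (fun v : R => mulr1 v) mulrA_sym.

End RegularBimodule.

(* The character group Hom(A, C^* ) of a finite abelian group A.              *)
Section Characters.

Variables (C : numClosedFieldType) (A : finZmodType).

Definition is_char (f : {ffun A -> C}) : bool :=
  [forall a, f a != 0] && [forall a, forall b, f (a + b) == f a * f b].

Record char := Char { char_val :> {ffun A -> C}; _ : is_char char_val }.

HB.instance Definition _ := [isSub for char_val].
HB.instance Definition _ := [Choice of char by <:].

Lemma char_neq0 (psi : char) a : psi a != 0.
Proof. by case: psi => f /= /andP[/forallP]. Qed.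

Lemma charD (psi : char) a b : psi (a + b) = psi a * psi b.
Proof. by case: psi => f /= /andP[_ /forallP/(_ a)/forallP/(_ b)/eqP]. Qed.

Lemma char0 (psi : char) : psi 0 = 1.
Proof.
apply: (mulfI (char_neq0 psi 0)).
by rewrite -charD addr0 mulr1.
Qed.

Lemma charP (phi psi : char) : (forall a, phi a = psi a) <-> phi = psi.
Proof. by split=> [e|->//]; apply/val_inj/ffunP. Qed.

Lemma charMn (psi : char) a n : psi (a *+ n) = psi a ^+ n.
Proof. by elim: n => [|n IH]; rewrite ?char0 // mulrS charD IH exprS. Qed.

Lemma char_unity (psi : char) a : psi a ^+ #|A| = 1.
Proof.
have prod_neq0 : \prod_(b : A) psi b != 0.
  by rewrite prodf_seq_neq0; apply/allP => b _; rewrite char_neq0.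
apply: (mulIf prod_neq0); rewrite mul1r -prodr_const -big_split /=.
rewrite [RHS](reindex_inj (addrI a)) /=.
by apply: eq_bigr => b _; rewrite charD.
Qed.

Let roots : seq C := sval (closed_field_poly_normal ('X^#|A| - 1 : {poly C})).

Let char_roots (psi : char) a : psi a \in roots.
Proof.
have A_gt0 : (0 < #|A|)%N by apply/card_gt0P; exists 0.
rewrite /roots; case: closed_field_poly_normal => rs /= rsE.
rewrite -root_prod_XsubC.
have -> : \prod_(z <- rs) ('X - z%:P) = 'X^#|A| - 1 :> {poly C}.
  by rewrite [RHS]rsE lead_coefXnsubC // scale1r.
by rewrite rootE !hornerE char_unity subrr.
Qed.

Let code (psi : char) : {ffun A -> seq_sub roots} :=
  [ffun a => SeqSub (char_roots psi a)].

Let decode (g : {ffun A -> seq_sub roots}) : option char :=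
  insub [ffun a => ssval (g a)].

Let codeK : pcancel code decode.
Proof.
move=> psi; rewrite /decode.
have -> : [ffun a => ssval (code psi a)] = val psi.
  by apply/ffunP => a; rewrite !ffunE.
exact: valK.
Qed.

HB.instance Definition _ : isCountable char := PCanIsCountable codeK.
HB.instance Definition _ : isFinite char := PCanIsFinite codeK.

Lemma mkchar_subproof (f : A -> C) :
    (forall a, f a != 0) -> (forall a b, f (a + b) = f a * f b) ->
  is_char (finfun f).
Proof.
move=> f_neq0 fD; apply/andP; split.
  by apply/forallP => a; rewrite ffunE.
by apply/forallP => a; apply/forallP => b; rewrite !ffunE fD.
Qed.

Definition mkchar (f : A -> C) f_neq0 fD : char :=
  Char (@mkchar_subproof f f_neq0 fD).

Let one_neq0 (a : A) : (1 : C) != 0. Proof. exact: oner_neq0. Qed.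
Let oneD (a b : A) : (1 : C) = 1 * 1. Proof. by rewrite mulr1. Qed.
Definition char_one : char := mkchar one_neq0 oneD.

Let mul_neq0 (phi psi : char) a : phi a * psi a != 0.
Proof. by rewrite mulf_neq0 ?char_neq0. Qed.
Let mulD (phi psi : char) a b :
  phi (a + b) * psi (a + b) = (phi a * psi a) * (phi b * psi b).
Proof. by rewrite !charD mulrACA. Qed.
Definition char_mul (phi psi : char) : char :=
  mkchar (mul_neq0 phi psi) (mulD phi psi).

Let inv_neq0 (psi : char) a : (psi a)^-1 != 0.
Proof. by rewrite invr_eq0 char_neq0. Qed.
Let invD (psi : char) a b : (psi (a + b))^-1 = (psi a)^-1 * (psi b)^-1.
Proof. by rewrite charD invfM. Qed.
Definition char_inv (psi : char) : char := mkchar (inv_neq0 psi) (invD psi).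

Let char_mulA : associative char_mul.
Proof. by move=> *; apply/charP => a; rewrite !ffunE mulrA. Qed.
Let char_mulC : commutative char_mul.
Proof. by move=> *; apply/charP => a; rewrite !ffunE mulrC. Qed.
Let char_mul1 : left_id char_one char_mul.
Proof. by move=> *; apply/charP => a; rewrite !ffunE mul1r. Qed.
Let char_mulV : left_inverse char_one char_inv char_mul.
Proof.
by move=> psi; apply/charP => a; rewrite !ffunE mulVf ?char_neq0.
Qed.

(* The zmodType operations are additive notation for pointwise multiplication. *)
HB.instance Definition _ :=
  GRing.isZmodule.Build char char_mulA char_mulC char_mul1 char_mulV.

Lemma char_addE (phi psi : char) a : (phi + psi) a = phi a * psi a.
Proof. by rewrite ffunE. Qed.

Lemma char_zeroE a : (0 : char) a = 1.
Proof. by rewrite ffunE. Qed.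

Lemma char_oppE (psi : char) a : (- psi) a = (psi a)^-1.
Proof. by rewrite ffunE. Qed.

End Characters.

Section CharacterBimodule.

Variables (C : numClosedFieldType) (R : finPzRingType) (M : finBimodType R).

Implicit Types (psi : char C M) (r : R) (v : M).

Let lscale_neq0 r psi v : psi (rscale v r) != 0. Proof. exact: char_neq0. Qed.
Let lscaleD r psi v w :
  psi (rscale (v + w) r) = psi (rscale v r) * psi (rscale w r).
Proof. by rewrite rscaleDl charD. Qed.
Definition char_lscale r psi : char C M :=
  mkchar (lscale_neq0 r psi) (lscaleD r psi).

Let rscale_neq0 psi r v : psi (lscale r v) != 0. Proof. exact: char_neq0. Qed.
Let rscaleD psi r v w :
  psi (lscale r (v + w)) = psi (lscale r v) * psi (lscale r w).
Proof. by rewrite lscaleDr charD. Qed.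
Definition char_rscale psi r : char C M :=
  mkchar (rscale_neq0 psi r) (rscaleD psi r).

Let char_lscaleDl r s psi :
  char_lscale (r + s) psi = char_lscale r psi + char_lscale s psi.
Proof. by apply/charP => v; rewrite !ffunE rscaleDr charD. Qed.
Let char_lscaleDr r phi psi :
  char_lscale r (phi + psi) = char_lscale r phi + char_lscale r psi.
Proof. by apply/charP => v; rewrite !ffunE. Qed.
Let char_lscaleA r s psi :
  char_lscale r (char_lscale s psi) = char_lscale (r * s) psi.
Proof. by apply/charP => v; rewrite !ffunE rscaleA. Qed.
Let char_lscale1 psi : char_lscale 1 psi = psi.
Proof. by apply/charP => v; rewrite !ffunE rscale1. Qed.
Let char_rscaleDl phi psi r :
  char_rscale (phi + psi) r = char_rscale phi r + char_rscale psi r.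
Proof. by apply/charP => v; rewrite !ffunE. Qed.
Let char_rscaleDr psi r s :
  char_rscale psi (r + s) = char_rscale psi r + char_rscale psi s.
Proof. by apply/charP => v; rewrite !ffunE lscaleDl charD. Qed.
Let char_rscaleA psi r s :
  char_rscale (char_rscale psi r) s = char_rscale psi (r * s).
Proof. by apply/charP => v; rewrite !ffunE lscaleA. Qed.
Let char_rscale1 psi : char_rscale psi 1 = psi.
Proof. by apply/charP => v; rewrite !ffunE lscale1. Qed.
Let char_rscale_lscale r psi s :
  char_rscale (char_lscale r psi) s = char_lscale r (char_rscale psi s).
Proof. by apply/charP => v; rewrite !ffunE rscale_lscale. Qed.

HB.instance Definition _ := Zmodule_isBimodule.Build R (char C M)
  char_lscaleDl char_lscaleDr char_lscaleA char_lscale1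
  char_rscaleDl char_rscaleDr char_rscaleA char_rscale1 char_rscale_lscale.

Lemma char_lscaleE r psi v : (lscale r psi) v = psi (rscale v r).
Proof. by rewrite ffunE. Qed.

Lemma char_rscaleE psi r v : (rscale psi r) v = psi (lscale r v).
Proof. by rewrite ffunE. Qed.

End CharacterBimodule.

Section Frobenius.

Variables (C : numClosedFieldType) (R : finPzRingType) (M : finBimodType R).

Definition frobenius_bimodule : Prop :=
  (exists2 f : {additive M -> char C R^o},
     bijective f & forall r v, f (lscale r v) = lscale r (f v)) /\
  (exists2 f : {additive M -> char C R^o},
     bijective f & forall v r, f (rscale v r) = rscale (f v) r).

Definition generating_character (chi : char C M) : Prop :=
  forall psi, exists r, psi = lscale r chi.

End Frobenius.

Section DualPartitions.

Definition dual_along (C : numClosedFieldType) (A B : finType)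
    (h : A -> B -> C) (P : {set {set A}}) : {set {set B}} :=
  equivalence_partition
    (fun b b' => [forall X in P, \sum_(a in X) h a b == \sum_(a in X) h a b'])
    [set: B].

Definition dual (C : numClosedFieldType) (A : finZmodType)
    (P : {set {set A}}) : {set {set char C A}} :=
  dual_along (fun a (psi : char C A) => psi a) P.

Section Evaluation.

Variables (C : numClosedFieldType) (A : finZmodType) (a : A).

Let eval_neq0 (psi : char C A) : psi a != 0. Proof. exact: char_neq0. Qed.
Let evalD (phi psi : char C A) : (phi + psi) a = phi a * psi a.
Proof. exact: char_addE. Qed.
Definition char_eval : char C (char C A) := mkchar eval_neq0 evalD.

End Evaluation.

(* A is identified with its double character group through char_eval.         *)
Definition reflexive_partition (C : numClosedFieldType) (A : finZmodType)
    (P : {set {set A}}) : Prop :=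
  [set [set char_eval C a | a in X] | X : {set A} in P] = dual C (dual C P).

Variables (C : numClosedFieldType) (R : finPzRingType) (M : finBimodType R).
Variables (n : nat) (chi : char C M).

Definition dotl (r : 'rV[R]_n) (v : 'rV[M]_n) : M := \sum_i lscale (r 0 i) (v 0 i).
Definition dotr (v : 'rV[M]_n) (r : 'rV[R]_n) : M := \sum_i rscale (v 0 i) (r 0 i).

Definition dual_l (P : {set {set 'rV[R]_n}}) : {set {set 'rV[M]_n}} :=
  dual_along (fun r v => chi (dotl r v)) P.
Definition dual_r (P : {set {set 'rV[R]_n}}) : {set {set 'rV[M]_n}} :=
  dual_along (fun r v => chi (dotr v r)) P.

(* For partitions of M^n, l uses <v, r> and r uses <r, v>.                    *)
Definition codual_l (Q : {set {set 'rV[M]_n}}) : {set {set 'rV[R]_n}} :=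
  dual_along (fun v r => chi (dotr v r)) Q.
Definition codual_r (Q : {set {set 'rV[M]_n}}) : {set {set 'rV[R]_n}} :=
  dual_along (fun v r => chi (dotl r v)) Q.

End DualPartitions.

Definition orbits (I X : finType) (act : I -> X -> X) (G : {set I}) :
    {set {set X}} :=
  [set [set act g x | g in G] | x : X].

Section MatrixActions.

Variables (R : finPzRingType) (n : nat).

(* MathComp's 'GL_n[R] requires R to be commutative and nontrivial.           *)
Definition GLset : {set 'M[R]_n} :=
  [set A | [exists B, (A *m B == 1%:M) && (B *m A == 1%:M)]].

Definition GL_subgroup (G : {set 'M[R]_n}) : Prop :=
  [/\ G \subset GLset,
      1%:M \in G,
      {in G &, forall A B, A *m B \in G}
    & {in G, forall A B, A *m B = 1%:M -> B *m A = 1%:M -> B \in G}].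

Definition orbitsR_right (G : {set 'M[R]_n}) : {set {set 'rV[R]_n}} :=
  orbits (fun (U : 'M[R]_n) (v : 'rV[R]_n) => v *m U) G.
Definition orbitsR_left (G : {set 'M[R]_n}) : {set {set 'rV[R]_n}} :=
  orbits (fun (U : 'M[R]_n) (v : 'rV[R]_n) => (U *m v^T)^T) G.

Variable M : finBimodType R.

(* v U and (U v^T)^T: matrix products with entries in M are not available.    *)
Definition orbitsM_right (G : {set 'M[R]_n}) : {set {set 'rV[M]_n}} :=
  orbits (fun (U : 'M[R]_n) (v : 'rV[M]_n) => \row_j \sum_i rscale (v 0 i) (U i j)) G.
Definition orbitsM_left (G : {set 'M[R]_n}) : {set {set 'rV[M]_n}} :=
  orbits (fun (U : 'M[R]_n) (v : 'rV[M]_n) => \row_i \sum_j lscale (U i j) (v 0 j)) G.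

End MatrixActions.

Arguments orbitsM_right {R n} M G.
Arguments orbitsM_left {R n} M G.

(* Main.v *)
(* Call h : A -> B -> C^* a perfect pairing if it is bimultiplicative and has  *)
(* trivial kernel on both sides; then |A| = |B| and B is the character group   *)
(* of A.  If a group G acts on A and B by h-adjoint maps, Fourier inversion    *)
(* shows that the orbit sums of h form mutually inverse matrices up to the     *)
(* factor |A|, so that the partition of B dual to the G-orbits of A is that of *)
(* the G-orbits of B and both have the same number of blocks; reflexivity      *)
(* follows by identifying B with the character group of A.  For M Frobenius    *)
(* with generating character chi, both chi <r, v> and chi <v, r> are perfect   *)
(* pairings between R^n and M^n, for which matrix actions are adjoint.         *)

(* Since characters separate points ([char_separates]), evaluation is a perfect pairing, so a finite
   abelian group has as many characters as elements. [orbit_sums_inverse] carries the duality: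
   points of [B] with equal orbit sums lie in one orbit ([dual_along_orbits]), and the two products
   of the mutually inverse matrices have the same trace, which counts orbits ([card_dual_orbits]).
   Specific to Frobenius bimodules is that [chi] pairs [R] and [M] perfectly on either side
   ([rpairing_perfect], [lpairing_perfect]). Associativity makes right multiplication on [R^n]
   adjoint to the left action on [M^n], and conversely, so the sides cross. *)
Require Import Defs.
From mathcomp Require Import all_boot all_order all_algebra all_field.
From mathcomp Require Import reals complex.

Set Implicit Arguments.
Unset Strict Implicit.
Unset Printing Implicit Defensive.
Import GRing.Theory Num.Theory.
Local Open Scope ring_scope.

(* The translation operators on C^A commute and have finite order, so they are *)
(* simultaneously diagonalizable; a diagonal entry that is not 1 for the       *)
(* nontrivial translation by x gives the character.                            *)
Lemma char_separates (C : numClosedFieldType) (A : finZmodType) (x : A) :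
  x != 0 -> exists psi : char C A, psi x != 1.
Proof.
move=> x_neq0; have [n cardA] : exists n, #|A| = n.+1.
  by exists #|A|.-1; rewrite prednK //; apply/card_gt0P; exists 0.
pose e (i : 'I_n.+1) : A := enum_val (cast_ord (esym cardA) i).
pose e' (a : A) : 'I_n.+1 := cast_ord cardA (enum_rank a).
have eK : cancel e e' by move=> i; rewrite /e /e' enum_valK cast_ordKV.
have e'K : cancel e' e by move=> a; rewrite /e /e' cast_ordK enum_rankK.
pose T (a : A) : 'M[C]_n.+1 := \matrix_(i, j) (e j == e i + a)%:R.
have TD a b : T (a + b) = T a * T b.
  apply/matrixP => i j; rewrite !mxE (bigD1 (e' (e i + a))) //= !mxE e'K eqxx.
  rewrite mul1r addrA big1 ?addr0 // => k; rewrite !mxE.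
  by rewrite (can2_eq eK e'K) => /negPf->; rewrite mul0r.
have T0 : T 0 = 1.
  by apply/matrixP => i j; rewrite !mxE addr0 (can_eq eK) eq_sym.
have TX a m : T (a *+ m) = T a ^+ m.
  by elim: m => [|m IH]; rewrite ?T0 // mulrS TD IH exprS.
have cardAmul (a : A) : a *+ n.+1 = 0.
  apply: (addrI (\sum_(b : A) b)); rewrite addr0 -cardA -sumr_const -big_split.
  by rewrite [RHS](reindex_inj (addIr a)).
have T_diag a : diagonalizable (T a).
  (* [T a] is annihilated by [X^|A| - 1], which has simple roots in characteristic 0. *)
  apply/diagonalizableP.
  have [rs rsE] := closed_field_poly_normal ('X^(n.+1) - 1 : {poly C}).
  rewrite lead_coefXnsubC // scale1r in rsE.
  exists rs; last first.
    rewrite -rsE; apply: mxminpoly_min.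
    by rewrite rmorphB rmorph1 rmorphXn /= horner_mx_X -TX cardAmul T0 subrr.
  rewrite -separable_prod_XsubC -rsE separable_Xn_sub_1 //.
  by rewrite pnatr_eq0.
have [|P Punit /allP PT] := (codiagonalizableP [seq T a | a <- enum A]).1.
  split=> [_ _ /mapP[a _ ->] /mapP[b _ ->]|_ /mapP[a _ ->]] //.
  by rewrite /comm_mx !mulmxE -!TD addrC.
pose D a := P *m T a *m invmx P.
have Ddiag a i j : i != j -> D a i j = 0.
  have /PT : T a \in [seq T a | a <- enum A] by rewrite map_f ?mem_enum.
  by rewrite /= /similar_to conjumx // => /is_diag_mxP; apply.
have DD a b : D (a + b) = D a *m D b.
  by rewrite /D TD -mulmxE !mulmxA mulmxKV.
have D0 : D 0 = 1%:M by rewrite /D T0 mulmx1 mulmxV.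
have [i Dx] : exists i, D x i i != 1.
  apply/existsP; apply: contraR x_neq0; rewrite negb_exists => /forallP D1.
  have DxE : D x = 1%:M.
    apply/matrixP => i j; rewrite [RHS]mxE.
    case: (eqVneq i j) => [<-|/Ddiag->//].
    by apply/eqP; rewrite -[_ == _]negbK D1.
  (* The entry of [T x] in row [0] and column [x] is 1; in the identity matrix this forces
     [x = 0]. *)
  have : T x = 1%:M.
    by rewrite -[T x](mulKmx Punit) -[P *m _](mulmxKV Punit) -/(D x) DxE mul1mx
       mulVmx.
  move/matrixP/(_ (e' 0) (e' x)); rewrite !mxE !e'K add0r eqxx (can_eq e'K).
  by rewrite eq_sym; case: eqP => // _ /eqP; rewrite oner_eq0.
have psiD a b : D (a + b) i i = D a i i * D b i i.
  rewrite DD mxE (bigD1 i) //= big1 ?addr0 // => k ki.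
  by rewrite Ddiag ?mul0r // eq_sym.
have psi_neq0 a : D a i i != 0.
  apply/eqP => Da0; have := psiD a (- a).
  by rewrite subrr D0 Da0 mul0r mxE eqxx => /eqP; rewrite oner_eq0.
by exists (mkchar psi_neq0 psiD); rewrite ffunE.
Qed.

(** * Perfect pairings and orthogonality *)

Section PerfectPairing.

Variable C : numClosedFieldType.

Definition perfect_pairing (A B : finZmodType) (h : A -> B -> C) : Prop :=
  [/\ forall a b, h a b != 0,
      forall b, {morph h^~ b : a a' / a + a' >-> a * a'},
      forall a, {morph h a : b b' / b + b' >-> b * b'},
      forall a, (forall b, h a b = 1) -> a = 0
    & forall b, (forall a, h a b = 1) -> b = 0].

Lemma perfect_pairingC (A B : finZmodType) (h : A -> B -> C) :
  perfect_pairing h -> perfect_pairing (fun b a => h a b).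
Proof. by case=> h0 hDl hDr nl nr; split. Qed.

(** Multiplying the two orbit-sum matrices in the other order exchanges [h] with its inverse. *)
Lemma perfect_pairingV (A B : finZmodType) (h : A -> B -> C) :
  perfect_pairing h -> perfect_pairing (fun a b => (h a b)^-1).
Proof.
case=> h0 hDl hDr nl nr; split=> [a b|b a a'|a b b'|a a1|b b1].
- by rewrite invr_eq0.
- by rewrite hDl invfM.
- by rewrite hDr invfM.
- by apply: nl => b; rewrite -[h a b]invrK a1 invr1.
- by apply: nr => a; rewrite -[h a b]invrK b1 invr1.
Qed.

Section Theory.

Variables (A B : finZmodType) (h : A -> B -> C).
Hypothesis h_perfect : perfect_pairing h.

Lemma perfect_pairing_neq0 a b : h a b != 0. Proof. by case: h_perfect. Qed.

Lemma perfect_pairingDl b : {morph h^~ b : a a' / a + a' >-> a * a'}.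
Proof. by case: h_perfect => _ + _ _ _; apply. Qed.

Lemma perfect_pairingDr a : {morph h a : b b' / b + b' >-> b * b'}.
Proof. by case: h_perfect => _ _ + _ _; apply. Qed.

Lemma perfect_pairing0r a : h a 0 = 1.
Proof.
apply: (mulfI (perfect_pairing_neq0 a 0)).
by rewrite -perfect_pairingDr addr0 mulr1.
Qed.

Lemma perfect_pairingBr a b b' : h a (b - b') = h a b / h a b'.
Proof.
apply: (canRL (mulfK (perfect_pairing_neq0 a b'))).
by rewrite -perfect_pairingDr subrK.
Qed.

Lemma perfect_pairing_inj b b' : (forall a, h a b = h a b') -> b = b'.
Proof.
move=> hbb'; apply/subr0_eq; case: h_perfect => _ _ _ _; apply=> a.
by rewrite perfect_pairingBr hbb' divff ?perfect_pairing_neq0.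
Qed.

(** For [b != 0] some [h a b] is not 1, while translating the summation variable by [a] multiplies
    the sum by it. *)
Lemma sum_perfect_pairing b : \sum_a h a b = #|A|%:R *+ (b == 0).
Proof.
case: eqVneq => [->|b_neq0].
  by under eq_bigr do rewrite perfect_pairing0r; rewrite sumr_const.
have [a ha] : exists a, h a b != 1.
  apply/existsP; apply: contraR b_neq0; rewrite negb_exists => /forallP h1.
  apply/eqP; case: h_perfect => _ _ _ _; apply=> a.
  by apply/eqP; rewrite -[_ == _]negbK h1.
apply/eqP; rewrite -(mulrI_eq0 _ (mulfI (_ : h a b - 1 != 0))) ?subr_eq0 //.
rewrite mulrBl mul1r mulr_sumr subr_eq0; apply/eqP.
rewrite [RHS](reindex_inj (addrI a)) /=.
by apply: eq_bigr => a' _; rewrite perfect_pairingDl.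
Qed.

Let char_neq0 b a : h a b != 0. Proof. exact: perfect_pairing_neq0. Qed.
Definition pairing_char (b : B) : char C A :=
  mkchar (char_neq0 b) (perfect_pairingDl b).

Lemma pairing_charE b a : pairing_char b a = h a b.
Proof. by rewrite ffunE. Qed.

Lemma pairing_char_inj : injective pairing_char.
Proof.
move=> b b' e; apply: perfect_pairing_inj => a.
by rewrite -!pairing_charE e.
Qed.

End Theory.

(** Orthogonality evaluates the sum of all values of [h] in both orders of summation. *)
Lemma card_perfect_pairing (A B : finZmodType) (h : A -> B -> C) :
  perfect_pairing h -> #|A| = #|B|.
Proof.
move=> hp; apply/eqP; rewrite -(eqr_nat C); apply/eqP.
transitivity (\sum_b \sum_a h a b).
  rewrite (bigD1 0) //= (sum_perfect_pairing hp) eqxx big1 ?addr0 // => b.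
  by rewrite (sum_perfect_pairing hp) => /negPf->.
have hp' := perfect_pairingC hp.
rewrite exchange_big (bigD1 0) //= (sum_perfect_pairing hp') eqxx.
by rewrite big1 ?addr0 // => a; rewrite (sum_perfect_pairing hp') => /negPf->.
Qed.

Lemma char_eval_perfect (A : finZmodType) :
  perfect_pairing (fun (a : A) (psi : char C A) => psi a).
Proof.
split=> [a psi|psi a a'|a phi psi|a a1|psi psi1].
- exact: char_neq0.
- exact: charD.
- exact: char_addE.
- apply/eqP; apply: contraT => /(char_separates C)[psi].
  by rewrite a1 eqxx.
- by apply/charP => a; rewrite psi1 char_zeroE.
Qed.

Lemma pairing_char_bij (A B : finZmodType) (h : A -> B -> C)
  (hp : perfect_pairing h) : bijective (pairing_char hp).
Proof.
apply: inj_card_bij; first exact: pairing_char_inj.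
rewrite -(card_perfect_pairing (char_eval_perfect A)).
by rewrite (card_perfect_pairing hp).
Qed.

End PerfectPairing.

(** * Orbits and adjoint actions *)

Section Orbits.

Variables (I X : finType) (act : I -> X -> X) (G : {set I}).

(* [G] is only a family of maps closed under composition and inverse: the      *)
(* order of composition is left free, so left and right actions both qualify.  *)
Definition acts_as_group : Prop :=
  [/\ exists2 e, e \in G & act e =1 id,
      {in G &, forall g k, exists2 m, m \in G & act m =1 act g \o act k}
    & {in G, forall g, exists2 k, k \in G & cancel (act g) (act k)}].

Definition orb x := [set act g x | g in G].

Hypothesis actG : acts_as_group.

Lemma orb_refl x : x \in orb x.
Proof. by have [[e eG e1] _ _] := actG; apply/imsetP; exists e. Qed.

Lemma orb_eq x y : y \in orb x -> orb y = orb x.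
Proof.
have [_ cG iG] := actG; case/imsetP=> g gG ->; apply/setP => z.
apply/imsetP/imsetP => -[k kG ->].
  by have [m mG mE] := cG k g kG gG; exists m; rewrite ?mE.
have [g' g'G gK] := iG g gG; have [m mG mE] := cG k g' kG g'G.
by exists m; rewrite // mE /= gK.
Qed.

Lemma act_inj g : g \in G -> injective (act g).
Proof. by case: actG => _ _ iG /iG[k _]; apply: can_inj. Qed.

Lemma sum_orb_act (V : nmodType) (F : X -> V) g x : g \in G ->
  \sum_(y in orb x) F (act g y) = \sum_(y in orb x) F y.
Proof.
move=> gG; have orbE : [set act g y | y in orb x] = orb x.
  apply/eqP; rewrite eqEcard card_imset ?leqnn ?andbT; last exact: act_inj.
  apply/subsetP => _ /imsetP[_ /imsetP[k kG ->] ->].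
  have [_ cG _] := actG; have [m mG mE] := cG g k gG kG.
  by apply/imsetP; exists m; rewrite ?mE.
by rewrite -[in RHS]orbE [RHS]big_imset //= => y z _ _; apply: act_inj.
Qed.

Lemma sum_orbits (V : nmodType) (F : X -> V) :
  \sum_(Y in orbits act G) \sum_(x in Y) F x = \sum_x F x.
Proof.
rewrite (partition_big_imset orb) /=; apply: eq_big => [Y|_ /imsetP[x _ ->]].
  by apply/imsetP/imsetP => -[x _ ->]; exists x.
apply: eq_bigl => y; apply/idP/eqP => [/orb_eq//|<-].
exact: orb_refl.
Qed.

End Orbits.

Section AdjointActions.

Variables (C : numClosedFieldType) (A B : finZmodType) (h : A -> B -> C).
Hypothesis hp : perfect_pairing h.
Variables (I : finType) (G : {set I}).
Variables (actA : I -> A -> A) (actB : I -> B -> B).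
Hypothesis adj : forall g a b, h (actA g a) b = h a (actB g b).

(** As [h] separates the points of [B], identities between the maps on [A] pass to their adjoints,
    with composition reversed. *)
Lemma adjoint_acts_as_group : acts_as_group actA G -> acts_as_group actB G.
Proof.
case=> [[e eG e1] cG iG]; split.
- exists e => // b; apply: (perfect_pairing_inj hp) => a.
  by rewrite -adj e1.
- move=> g k gG kG; have [m mG mE] := cG k g kG gG; exists m => // b.
  by apply: (perfect_pairing_inj hp) => a; rewrite /= -!adj mE.
- move=> g gG; have [k kG gK] := iG g gG; exists k => // b.
  have gK' := canF_sym gK.
  by apply: (perfect_pairing_inj hp) => a; rewrite -!adj gK'.
Qed.

End AdjointActions.

(** * Fourier inversion on orbits and its consequences *)

Section DualOrbits.

Variables (C : numClosedFieldType) (A B : finZmodType) (h : A -> B -> C).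
Hypothesis hp : perfect_pairing h.
Variables (I : finType) (G : {set I}).
Variables (actA : I -> A -> A) (actB : I -> B -> B).
Hypothesis adj : forall g a b, h (actA g a) b = h a (actB g b).
Hypotheses (actAG : acts_as_group actA G) (actBG : acts_as_group actB G).

(* Fourier inversion restricted to orbit sums: the two families of orbit sums *)
(* form, up to the factor |A|, mutually inverse matrices.                     *)
Lemma orbit_sums_inverse (r : {set A} -> A) b b0 :
    (forall X, X \in orbits actA G -> r X \in X) ->
  \sum_(X in orbits actA G)
    (\sum_(a in X) h a b) * (\sum_(y in orb actB G b0) (h (r X) y)^-1) =
  #|A|%:R *+ (b \in orb actB G b0).
Proof.
move=> rP; pose f a := \sum_(y in orb actB G b0) (h a y)^-1.
have f_act g a : g \in G -> f (actA g a) = f a.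
  move=> gG; rewrite /f -[RHS](sum_orb_act actBG _ _ gG).
  by apply: eq_bigr => y _; rewrite adj.
have f_const X a : X \in orbits actA G -> a \in X -> f (r X) = f a.
  move=> XP; have := rP X XP; case/imsetP: XP => x _ ->.
  by case/imsetP=> k kG -> /imsetP[l lG ->]; rewrite !f_act.
(* Since [f] is constant on orbits, the sum over orbits unfolds to all of [A]; orthogonality then
   keeps only the term [y = b]. *)
transitivity (\sum_a h a b * f a).
  rewrite -(sum_orbits actAG); apply: eq_bigr => X XP.
  rewrite -/(f (r X)) mulr_suml; apply: eq_bigr => a aX.
  by rewrite (f_const _ _ XP aX).
under eq_bigr do rewrite mulr_sumr; rewrite exchange_big /=.
under eq_bigr => y _ do (under eq_bigr do rewrite -(perfect_pairingBr hp);
  rewrite (sum_perfect_pairing hp) subr_eq0).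
case: (boolP (b \in _)) => [bY|bY]; last first.
  by rewrite big1 // => y yY; case: eqP bY yY => // -> /negPf->.
rewrite (bigD1 b) //= eqxx big1 ?addr0 // => y /andP[_].
by rewrite eq_sym => /negPf->.
Qed.

End DualOrbits.

(** Orbits are nonempty, so the default [0] is never reached on them. *)
Definition block_repr (A : finZmodType) (X : {set A}) : A :=
  odflt 0 [pick x in X].

Lemma block_repr_orbit (A : finZmodType) (I : finType) (act : I -> A -> A)
  (G : {set I}) (X : {set A}) : acts_as_group act G ->
  X \in orbits act G -> block_repr X \in X.
Proof.
move=> actG /imsetP[x _ ->]; rewrite /block_repr; case: pickP => //= X0.
by have := X0 x; rewrite (orb_refl actG x : x \in [set _ | _ in _]).
Qed.

Section DualOrbitPartitions.

Variables (C : numClosedFieldType) (A B : finZmodType) (h : A -> B -> C).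
Hypothesis hp : perfect_pairing h.
Variables (I : finType) (G : {set I}).
Variables (actA : I -> A -> A) (actB : I -> B -> B).
Hypothesis adj : forall g a b, h (actA g a) b = h a (actB g b).
Hypothesis actAG : acts_as_group actA G.

(** Equal orbit sums at [b] and [b'] give equal values in the inversion formula for the orbit of
    [b]: the value at [b] is |A|, so [b'] cannot lie outside. The converse is adjointness. *)
Lemma dual_along_orbits : dual_along h (orbits actA G) = orbits actB G.
Proof.
have actBG := adjoint_acts_as_group hp adj actAG.
have rP := fun X => block_repr_orbit actAG (X := X).
suff blockE b : [set b' in [set: B] | [forall X in orbits actA G,
    \sum_(a in X) h a b == \sum_(a in X) h a b']] = orb actB G b.
  by apply/setP => Y; apply/imsetP/imsetP => -[b _ ->]; exists b;
    rewrite ?inE //= blockE.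
apply/setP => b'; rewrite !inE /=; apply/forall_inP/idP => [sums|].
  have := orbit_sums_inverse hp adj actAG actBG b b rP.
  rewrite orb_refl // (eq_bigr _ (fun X XP => congr1 ( *%R^~ _)
    (eqP (sums X XP)))) orbit_sums_inverse //.
  case: (b' \in _) => // /esym/eqP; rewrite pnatr_eq0 => /eqP/card0_eq/(_ 0).
  by rewrite inE.
case/imsetP=> g gG -> _ /imsetP[x _ ->]; apply/eqP.
rewrite -[LHS](sum_orb_act actAG _ _ gG).
by apply: eq_bigr => a _; rewrite adj.
Qed.

(** [T] is the common trace of the two products of the orbit-sum matrices: |B| times the number of
    orbits on [A], and |A| times that on [B]. *)
Lemma card_dual_orbits : #|orbits actA G| = #|orbits actB G|.
Proof.
have actBG := adjoint_acts_as_group hp adj actAG.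
have hp' := perfect_pairingV (perfect_pairingC hp).
have adj' g b a : (h a (actB g b))^-1 = (h (actA g a) b)^-1 by rewrite adj.
have A_neq0 : #|A|%:R != 0 :> C.
  by rewrite pnatr_eq0 -lt0n; apply/card_gt0P; exists 0.
have rA := fun X => block_repr_orbit actAG (X := X).
have rB := fun Y => block_repr_orbit actBG (X := Y).
apply/eqP; rewrite -(eqr_nat C) -(inj_eq (mulfI A_neq0)); apply/eqP.
pose T := \sum_(X in orbits actA G) \sum_(Y in orbits actB G)
  (\sum_(a in X) h a (block_repr Y)) * (\sum_(b in Y) (h (block_repr X) b)^-1).
transitivity T.
  rewrite (card_perfect_pairing hp) mulr_natr -sumr_const.
  apply: eq_bigr => X XP; have rX := rA X XP.
  have [x _ XE] := imsetP XP.
  have := orbit_sums_inverse hp' adj' actBG actAG (block_repr X) x rB.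
  rewrite /orb -XE rX mulr1n => <-; apply: eq_bigr => Y _; rewrite mulrC.
  by congr (_ * _); apply: eq_bigr => a _; rewrite invrK.
rewrite mulr_natr -sumr_const /T exchange_big; apply: eq_bigr => Y YQ /=.
have rY := rB Y YQ; have [y _ YE] := imsetP YQ.
have := orbit_sums_inverse hp adj actAG actBG (block_repr Y) y rA.
by rewrite /orb -YE rY mulr1n.
Qed.

End DualOrbitPartitions.

Lemma dual_along_image_codomain (C : numClosedFieldType) (A B B' : finType)
    (h : A -> B -> C) (h' : A -> B' -> C) (e : B -> B') (P : {set {set A}}) :
    bijective e -> (forall a b, h' a (e b) = h a b) ->
  dual_along h' P = [set [set e b | b in Y] | Y : {set B} in dual_along h P].
Proof.
case=> e' eK e'K he; rewrite -imset_comp /=.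
suff blockE b :
    [set c in [set: B'] | [forall X in P, \sum_(a in X) h' a (e b) ==
       \sum_(a in X) h' a c]] =
    [set e b' | b' in [set b' in [set: B] | [forall X in P,
      \sum_(a in X) h a b == \sum_(a in X) h a b']]].
  apply/setP => Y; apply/imsetP/imsetP => -[b _ ->].
    by exists (e' b); rewrite ?inE //= -blockE e'K.
  by exists (e b); rewrite ?inE //= blockE.
apply/setP => c; rewrite -[c]e'K (mem_imset _ _ (can_inj eK)) !inE /=.
by apply: eq_forallb => X; congr (_ ==> (_ == _)); apply: eq_bigr => a _.
Qed.

Lemma dual_along_image_domain (C : numClosedFieldType) (A A' B : finType)
    (h : A -> B -> C) (h' : A' -> B -> C) (e : A -> A') (P : {set {set A}}) :
    injective e -> (forall a b, h' (e a) b = h a b) ->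
  dual_along h' [set [set e a | a in X] | X : {set A} in P] = dual_along h P.
Proof.
move=> e_inj he.
have sumE (X : {set A}) b :
    \sum_(a' in [set e a | a in X]) h' a' b = \sum_(a in X) h a b.
  by rewrite big_imset /=; [apply: eq_bigr | move=> ? ? _ _; apply: e_inj].
apply: eq_imset => b; apply/setP => b'; rewrite !inE /=.
apply/forall_inP/forall_inP => sums X.
  by rewrite -!sumE => XP; rewrite sums ?imset_f.
by case/imsetP=> Y YP ->; rewrite !sumE sums.
Qed.

Section ReflexiveOrbitPartitions.

Variables (C : numClosedFieldType) (A B : finZmodType) (h : A -> B -> C).
Hypothesis hp : perfect_pairing h.
Variables (I : finType) (G : {set I}).
Variables (actA : I -> A -> A) (actB : I -> B -> B).
Hypothesis adj : forall g a b, h (actA g a) b = h a (actB g b).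
Hypothesis actAG : acts_as_group actA G.

(** [pairing_char] identifies [B] with the character group of [A], and evaluation identifies [A]
    with the double one. Both duals thus become duals along [h], and [dual_along_orbits] applies
    twice. *)
Lemma reflexive_orbits : reflexive_partition C (orbits actA G).
Proof.
have actBG := adjoint_acts_as_group hp adj actAG.
have adj' g b a : h a (actB g b) = h (actA g a) b by rewrite adj.
have charE a b : pairing_char hp b a = h a b := pairing_charE hp b a.
have ep := perfect_pairingC (char_eval_perfect C A).
have evalE a : char_eval C a = pairing_char ep a.
  by apply/charP => psi; rewrite !ffunE.
rewrite /reflexive_partition /dual.
rewrite (dual_along_image_codomain _ (pairing_char_bij hp) charE).
rewrite (dual_along_orbits hp adj actAG).
rewrite (dual_along_image_domain (h := fun b (xi : char C (char C A)) =>
  xi (pairing_char hp b)) _ (pairing_char_inj (h_perfect := hp))) //.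
rewrite (dual_along_image_codomain (h := fun b a => h a b)
  _ (pairing_char_bij ep)); last by move=> b a; rewrite pairing_charE charE.
rewrite (dual_along_orbits (perfect_pairingC hp) adj' actBG).
by apply: eq_imset => X; apply: eq_imset => a; rewrite evalE.
Qed.

End ReflexiveOrbitPartitions.

(** * The pairings of rows over a bimodule *)

Section BimoduleSums.

Variables (R : finPzRingType) (M : finBimodType R).

Lemma lscale0r (s : R) : lscale s (0 : M) = 0.
Proof. by apply: (addrI (lscale s 0)); rewrite -lscaleDr !addr0. Qed.

Lemma lscale0l (w : M) : lscale (0 : R) w = 0.
Proof. by apply: (addrI (lscale 0 w)); rewrite -lscaleDl !addr0. Qed.

Lemma rscale0r (w : M) : rscale w (0 : R) = 0.
Proof. by apply: (addrI (rscale w 0)); rewrite -rscaleDr !addr0. Qed.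

Lemma rscale0l (s : R) : rscale (0 : M) s = 0.
Proof. by apply: (addrI (rscale 0 s)); rewrite -rscaleDl !addr0. Qed.

Lemma lscale_sumr (J : finType) (r : R) (F : J -> M) :
  lscale r (\sum_j F j) = \sum_j lscale r (F j).
Proof.
apply: big_morph => [v w|]; [exact: lscaleDr | exact: lscale0r].
Qed.

Lemma lscale_suml (J : finType) (F : J -> R) (v : M) :
  lscale (\sum_j F j) v = \sum_j lscale (F j) v.
Proof.
apply: (big_morph (fun r => lscale r v)) => [r s|].
  exact: lscaleDl.
exact: lscale0l.
Qed.

Lemma rscale_sumr (J : finType) (v : M) (F : J -> R) :
  rscale v (\sum_j F j) = \sum_j rscale v (F j).
Proof.
apply: big_morph => [r s|]; [exact: rscaleDr | exact: rscale0r].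
Qed.

Lemma rscale_suml (J : finType) (F : J -> M) (r : R) :
  rscale (\sum_j F j) r = \sum_j rscale (F j) r.
Proof.
apply: (big_morph (fun v => rscale v r)) => [v w|].
  exact: rscaleDl.
exact: rscale0l.
Qed.

Variable n : nat.
Implicit Types (r : 'rV[R]_n) (v : 'rV[M]_n).

Lemma dotlDl r s v : dotl (r + s) v = dotl r v + dotl s v.
Proof.
by rewrite /dotl -big_split; apply: eq_bigr => i _; rewrite mxE lscaleDl.
Qed.

Lemma dotlDr r v w : dotl r (v + w) = dotl r v + dotl r w.
Proof.
by rewrite /dotl -big_split; apply: eq_bigr => i _; rewrite mxE lscaleDr.
Qed.

Lemma dotrDl v w r : dotr (v + w) r = dotr v r + dotr w r.
Proof.
by rewrite /dotr -big_split; apply: eq_bigr => i _; rewrite mxE rscaleDl.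
Qed.

Lemma dotrDr v r s : dotr v (r + s) = dotr v r + dotr v s.
Proof.
by rewrite /dotr -big_split; apply: eq_bigr => i _; rewrite mxE rscaleDr.
Qed.

(** Test vectors that reduce the kernels of the row pairings to the case of one entry. *)
Definition coord_row (V : zmodType) (i : 'I_n) (x : V) : 'rV[V]_n :=
  \row_j (if j == i then x else 0).

Lemma dotl_coordl i (s : R) v : dotl (coord_row i s) v = lscale s (v 0 i).
Proof.
rewrite /dotl (bigD1 i) //= mxE eqxx big1 ?addr0 // => j /negPf ji.
by rewrite mxE ji lscale0l.
Qed.

Lemma dotl_coordr i r (w : M) : dotl r (coord_row i w) = lscale (r 0 i) w.
Proof.
rewrite /dotl (bigD1 i) //= mxE eqxx big1 ?addr0 // => j /negPf ji.
by rewrite mxE ji lscale0r.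
Qed.

Lemma dotr_coordl i (w : M) r : dotr (coord_row i w) r = rscale w (r 0 i).
Proof.
rewrite /dotr (bigD1 i) //= mxE eqxx big1 ?addr0 // => j /negPf ji.
by rewrite mxE ji rscale0l.
Qed.

Lemma dotr_coordr i v (s : R) : dotr v (coord_row i s) = rscale (v 0 i) s.
Proof.
rewrite /dotr (bigD1 i) //= mxE eqxx big1 ?addr0 // => j /negPf ji.
by rewrite mxE ji rscale0r.
Qed.

Lemma dotl_mulmx (U : 'M[R]_n) r v :
  dotl (r *m U) v = dotl r (\row_i \sum_j lscale (U i j) (v 0 j)).
Proof.
rewrite /dotl; under eq_bigr => j _ do rewrite mxE lscale_suml.
rewrite exchange_big; apply: eq_bigr => i _ /=; rewrite mxE lscale_sumr.
by apply: eq_bigr => j _; rewrite lscaleA.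
Qed.

Lemma dotr_mulmx (U : 'M[R]_n) r v :
  dotr v (U *m r^T)^T = dotr (\row_j \sum_i rscale (v 0 i) (U i j)) r.
Proof.
rewrite /dotr; under eq_bigr => i _ do rewrite !mxE rscale_sumr.
rewrite exchange_big; apply: eq_bigr => i _ /=; rewrite mxE rscale_suml.
by apply: eq_bigr => j _; rewrite mxE rscaleA.
Qed.

End BimoduleSums.

(** * Perfectness of the pairings given by a generating character *)

Section FrobeniusBimodule.

Variables (C : numClosedFieldType) (R : finPzRingType) (M : finBimodType R).
Variable chi : char C M.
Hypothesis frobM : frobenius_bimodule C M.
Hypothesis chi_gen : generating_character chi.

(** All characters of [M] are multiples of [chi], so separation of points kills the kernel in [M]. A
    Frobenius isomorphism gives |char M| = |R|, so the surjection sending [r] to [lscale r chi] is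
    injective, which kills the kernel in [R]. *)
Lemma rpairing_perfect :
  perfect_pairing (fun (v : M) (r : R) => chi (rscale v r)).
Proof.
have nl (v : M) : (forall r, chi (rscale v r) = 1) -> v = 0.
  move=> chiv; apply/eqP; apply: contraT => /(char_separates C)[psi].
  by have [r ->] := chi_gen psi; rewrite char_lscaleE chiv eqxx.
have [[f [f' fK f'K] _] _] := frobM.
have cardMR : #|{: char C M}| = #|R|.
  rewrite -(card_perfect_pairing (char_eval_perfect C M)).
  rewrite (bij_eq_card (f := f)); last by exists f'.
  exact: esym (card_perfect_pairing (char_eval_perfect C R^o)).
have gen_onto : forall psi : char C M, exists r : R, lscale r chi == psi.
  by move=> psi; have [r ->] := chi_gen psi; exists r.
pose g psi := xchoose (gen_onto psi).
have gK : cancel g (fun r => lscale r chi).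
  by move=> psi; apply/eqP/(xchooseP (gen_onto psi)).
have g_bij : bijective g.
  by apply: inj_card_bij; [exact: can_inj gK | rewrite cardMR].
have chi_inj : injective (fun r : R => lscale r chi).
  by apply: can_inj; exact: (bij_can_sym g_bij _).2 gK.
split=> // [v r|r v w|v r s|r chir].
- exact: char_neq0.
- by rewrite rscaleDl charD.
- by rewrite rscaleDr charD.
apply: chi_inj; apply/charP => v; rewrite !char_lscaleE chir.
by rewrite rscale0r char0.
Qed.

(* Under a left isomorphism [f : M -> char R] the character [chi] becomes      *)
(* evaluation at some [a], so [chi (lscale r v) = f v (a * r)] and it suffices *)
(* that [a] be a unit.  Since [chi] generates, [f v 1 = chi (rscale v s)] for  *)
(* some [s]; rewriting the right side as [f v (c * a)] gives [c * a = 1].      *)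
Lemma lpairing_perfect :
  perfect_pairing (fun (r : R) (v : M) => chi (lscale r v)).
Proof.
have [[f f_bij fZ] _] := frobM.
have fp : perfect_pairing (fun (v : M) (r : R^o) => f v r).
  split=> [v r|r v w|v r s|v fv|r fr].
  - exact: char_neq0.
  - by rewrite raddfD char_addE.
  - exact: charD.
  - apply: (bij_inj f_bij); rewrite raddf0; apply/charP => r.
    by rewrite fv char_zeroE.
  - apply/eqP; apply: contraT => /(char_separates C)[psi].
    by have [f' _ f'K] := f_bij; rewrite -[psi]f'K fr eqxx.
(* Double duality: every character of [M] is evaluation of [f] at an element of [R]. *)
have surj (psi : char C M) : exists a : R^o, forall v, f v a = psi v.
  have [b' _ b'K] := pairing_char_bij fp.
  by exists (b' psi) => v; rewrite -[psi in RHS]b'K pairing_charE.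
have [a chiE] := surj chi.
have fE r v x : f (lscale r v) x = f v (x * r).
  by rewrite fZ char_lscaleE.
have [s sE] : exists s : R, forall v, f v 1 = chi (rscale v s).
  have [s sE] := chi_gen (pairing_char fp (1 : R)).
  by exists s => v; rewrite -char_lscaleE -sE pairing_charE.
have [c cE] : exists c : R, forall v, f (rscale v s) 1 = f v c.
  have fs0 v : f (rscale v s) 1 != 0 by exact: char_neq0.
  have fsD v w : f (rscale (v + w) s) 1 = f (rscale v s) 1 * f (rscale w s) 1.
    by rewrite rscaleDl raddfD char_addE.
  by have [c cE] := surj (mkchar fs0 fsD); exists c => v; rewrite cE ffunE.
have ca1 : c * a = 1.
  apply: (perfect_pairing_inj fp) => v.
  by rewrite sE -chiE -(fE a) -cE rscale_lscale fE mul1r.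
have a_inj : injective ( *%R a).
  by move=> x y axy; rewrite -[x]mul1r -ca1 -mulrA axy mulrA ca1 mul1r.
split=> [r v|v r s'|r v w|r chir|v chiv].
- exact: char_neq0.
- by rewrite lscaleDl charD.
- by rewrite lscaleDr charD.
- apply: a_inj; rewrite mulr0; apply: (perfect_pairing_inj fp) => v.
  by rewrite (perfect_pairing0r fp) -fE chiE chir.
(* As [R] is finite, left multiplication by [a] is onto, so [x] is a right multiple of [a]. *)
- case: fp => _ _ _ + _; apply=> x; have [a' _ a'K] := injF_bij a_inj.
  by rewrite -[x]a'K -fE chiE chiv.
Qed.

Lemma dotl_perfect n :
  perfect_pairing (fun (r : 'rV[R]_n) (v : 'rV[M]_n) => chi (dotl r v)).
Proof.
have [_ _ _ nl nr] := lpairing_perfect.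
split=> [r v|v r s|r v w|r chir|v chiv].
- exact: char_neq0.
- by rewrite dotlDl charD.
- by rewrite dotlDr charD.
- by apply/rowP => i; rewrite mxE; apply: nl => w; rewrite -dotl_coordr.
- by apply/rowP => i; rewrite mxE; apply: nr => s; rewrite -dotl_coordl.
Qed.

Lemma dotr_perfect n :
  perfect_pairing (fun (v : 'rV[M]_n) (r : 'rV[R]_n) => chi (dotr v r)).
Proof.
have [_ _ _ nl nr] := rpairing_perfect.
split=> [v r|r v w|v r s|v chiv|r chir].
- exact: char_neq0.
- by rewrite dotrDl charD.
- by rewrite dotrDr charD.
- by apply/rowP => i; rewrite mxE; apply: nl => s; rewrite -dotr_coordr.
- by apply/rowP => i; rewrite mxE; apply: nr => w; rewrite -dotr_coordl.
Qed.

End FrobeniusBimodule.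

(** * Matrix actions on rows over the ring *)

Section MatrixGroup.

Variables (R : finPzRingType) (n : nat) (G : {set 'M[R]_n}).
Hypothesis subG : GL_subgroup G.

Lemma right_mulmx_acts :
  acts_as_group (fun (U : 'M[R]_n) (r : 'rV[R]_n) => r *m U) G.
Proof.
have [/subsetP sGL G1 GM GV] := subG; split.
- by exists 1%:M => // r; rewrite mulmx1.
- by move=> U W UG WG; exists (W *m U); rewrite ?GM // => r; rewrite /= mulmxA.
move=> U UG; have := sGL U UG.
rewrite inE => /existsP[W /andP[/eqP UW /eqP WU]].
by exists W => [|r]; [exact: GV UW WU | rewrite -mulmxA UW mulmx1].
Qed.

Lemma left_mulmx_acts :
  acts_as_group (fun (U : 'M[R]_n) (r : 'rV[R]_n) => (U *m r^T)^T) G.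
Proof.
have [/subsetP sGL G1 GM GV] := subG; split.
- by exists 1%:M => // r; rewrite mul1mx trmxK.
- move=> U W UG WG; exists (U *m W); rewrite ?GM // => r /=.
  by rewrite trmxK mulmxA.
move=> U UG; have := sGL U UG.
rewrite inE => /existsP[W /andP[/eqP UW /eqP WU]].
exists W => [|r]; first exact: GV UW WU.
by rewrite trmxK mulmxA WU mul1mx trmxK.
Qed.

End MatrixGroup.

Theorem theorem3p9 (RR : realType) (R : finPzRingType) (M : finBimodType R)
    (chi : char RR[i] M) (n : nat) (G : {set 'M[R]_n})
    (frobM : frobenius_bimodule RR[i] M) (chi_gen : generating_character chi)
    (subG : GL_subgroup G) :
  [/\ orbitsR_right G = codual_r chi (orbitsM_left M G),
      orbitsR_left G = codual_l chi (orbitsM_right M G),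
      orbitsM_right M G = dual_r chi (orbitsR_left G)
    & orbitsM_left M G = dual_l chi (orbitsR_right G)] /\
  [/\ reflexive_partition RR[i] (orbitsR_right G),
      reflexive_partition RR[i] (orbitsR_left G),
      reflexive_partition RR[i] (orbitsM_right M G)
    & reflexive_partition RR[i] (orbitsM_left M G)] /\
  (#|orbitsR_right G| = #|orbitsM_left M G| /\
   #|orbitsR_left G| = #|orbitsM_right M G|).
Proof.
have lp := dotl_perfect frobM chi_gen n.
have lp' := perfect_pairingC lp.
have rp' := dotr_perfect frobM chi_gen n.
have rp := perfect_pairingC rp'.
have ladj (U : 'M[R]_n) (r : 'rV[R]_n) (v : 'rV[M]_n) :=
  congr1 chi (dotl_mulmx U r v).
have radj (U : 'M[R]_n) (r : 'rV[R]_n) (v : 'rV[M]_n) :=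
  congr1 chi (dotr_mulmx U r v).
have ladj' U v r := esym (ladj U r v).
have radj' U v r := esym (radj U r v).
have Rr := right_mulmx_acts subG.
have Rl := left_mulmx_acts subG.
(* The group laws on [M^n] are inherited from [R^n] through adjointness. *)
have Ml := adjoint_acts_as_group lp ladj Rr.
have Mr := adjoint_acts_as_group rp radj Rl.
split; [|split]; split.
- exact: esym (dual_along_orbits lp' ladj' Ml).
- exact: esym (dual_along_orbits rp' radj' Mr).
- exact: esym (dual_along_orbits rp radj Rl).
- exact: esym (dual_along_orbits lp ladj Rr).
- exact (reflexive_orbits lp ladj Rr).
- exact (reflexive_orbits rp radj Rl).
- exact (reflexive_orbits rp' radj' Mr).
- exact (reflexive_orbits lp' ladj' Ml).
- exact (card_dual_orbits lp ladj Rr).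
- exact (card_dual_orbits rp radj Rl).
Qed.
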